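(* Let $(Q,+,\cdot,\le)$ be an ordered field and $n\ge 2$, and assume $n=2$ or that $(Q,+,\cdot,\le)$ is a Euclidean field. Let $\rho\in\{\tau,\sigma\}$. If a binary relation $R$ on $Q^n$ is definable in $(Q^n,\rho)$ by an existential formula with 2 quantifiers or by a universal formula with 2 quantifiers, then $R$ is definable in $(Q^n,\rho)$ by a quantifier-free formula; that is, $R$ is one of the 8 relations obtained from $\rho$ and $=$ by Boolean operations (intersection, union, complement relative to $Q^n\times Q^n$).
   Context: For $p=(p_0,\dots,p_{n-1}),\,q=(q_0,\dots,q_{n-1})\in Q^n$: $p\,\tau\,q$ iff $(p_0-q_0)^2>\sum_{i=1}^{n-1}(p_i-q_i)^2$; $p\,\sigma\,q$ iff $(p_0-q_0)^2<\sum_{i=1}^{n-1}(p_i-q_i)^2$. An ordered field is Euclidean if every nonnegative element is a square. An existential (universal) formula with 2 quantifiers is one of the form $\exists z_1\exists z_2\,\psi(p,q,z_1,z_2)$ (resp. $\forall z_1\forall z_2\,\psi$) with $\psi$ quantifier-free in the language with equality and one binary relation symbol interpreted as $\rho$; definitions are without parameters. *)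

(* Defs.v *)
From mathcomp Require Import all_boot all_order all_algebra.
From mathcomp Require Import boolp classical_sets functions cardinality.

Set Implicit Arguments.
Unset Strict Implicit.
Unset Printing Implicit Defensive.

Import Order.TTheory GRing.Theory Num.Theory.
Local Open Scope classical_set_scope.
Local Open Scope ring_scope.

Definition euclidean (Q : realFieldType) : Prop :=
  forall x : Q, 0 <= x -> exists y : Q, x = y ^+ 2.

Section Causality.
Variables (Q : realFieldType) (n : nat) (hn : (2 <= n)%N).

Definition time_index : 'I_n := Ordinal (ltnW hn).

Definition time_sq (p q : 'rV[Q]_n) : Q :=
  (p 0 time_index - q 0 time_index) ^+ 2.

Definition space_sq (p q : 'rV[Q]_n) : Q :=
  \sum_(i < n | (1 <= i)%N) (p 0 i - q 0 i) ^+ 2.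

Definition tau : set ('rV[Q]_n * 'rV[Q]_n) :=
  [set pq | time_sq pq.1 pq.2 > space_sq pq.1 pq.2].

Definition sigma : set ('rV[Q]_n * 'rV[Q]_n) :=
  [set pq | time_sq pq.1 pq.2 < space_sq pq.1 pq.2].

End Causality.

(* First-order formulas with free variables indexed by 'I_k, in the language
   with equality and one binary relation symbol.  Variables are de Bruijn
   indices: in the body of a quantifier, index 0 is the bound variable and
   index i.+1 is the variable i of the enclosing context. *)
Inductive formula (k : nat) : Type :=
| FEq (i j : 'I_k)
| FRel (i j : 'I_k)
| FNot (f : formula k)
| FAnd (f g : formula k)
| FOr (f g : formula k)
| FExists (f : formula k.+1)
| FForall (f : formula k.+1).

Fixpoint quantifier_free (k : nat) (f : formula k) : bool :=
  match f with
  | FEq _ _ | FRel _ _ => true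
  | FNot g => quantifier_free g
  | FAnd g h | FOr g h => quantifier_free g && quantifier_free h
  | FExists _ | FForall _ => false
  end.

Definition existential2 (f : formula 2) : Prop :=
  exists2 psi : formula 4, quantifier_free psi & f = FExists (FExists psi).

Definition universal2 (f : formula 2) : Prop :=
  exists2 psi : formula 4, quantifier_free psi & f = FForall (FForall psi).

Section Definability.
Variables (T : Type) (rho : set (T * T)).

Definition extend_env (k : nat) (x : T) (e : 'I_k -> T) : 'I_k.+1 -> T :=
  fun i => if unlift ord0 i is Some j then e j else x.

Fixpoint sat (k : nat) (e : 'I_k -> T) (f : formula k) : Prop :=
  match f with
  | FEq i j => e i = e j
  | FRel i j => rho (e i, e j)
  | FNot g => ~ sat e g
  | FAnd g h => sat e g /\ sat e h
  | FOr g h => sat e g \/ sat e h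
  | FExists g => exists x : T, sat (extend_env x e) g
  | FForall g => forall x : T, sat (extend_env x e) g
  end.

Definition pair_env (p q : T) : 'I_2 -> T :=
  fun i => if i == ord0 then p else q.

Definition definable_by (C : formula 2 -> Prop) (R : set (T * T)) : Prop :=
  exists2 f : formula 2, C f & forall p q, R (p, q) <-> sat (pair_env p q) f.

(* The relations obtained from rho and equality by Boolean operations, the
   complement being relative to T * T. *)
Inductive boolean_closure : set (T * T) -> Prop :=
| closure_rho : boolean_closure rho
| closure_eq : boolean_closure [set pq | pq.1 = pq.2]
| closureI A B :
    boolean_closure A -> boolean_closure B -> boolean_closure (A `&` B)
| closureU A B :
    boolean_closure A -> boolean_closure B -> boolean_closure (A `|` B)
| closureC A : boolean_closure A -> boolean_closure (~` A).

End Definability.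

(* Main.v *)
(* If all quadruples (p, q, x, y) of distinct points extending a pair of
distinct points realise every graph on the edges other than pq, then the
quantifier-free type of (p, q) determines which quantifier-free types of
quadruples extend it, hence the truth of every two-quantifier formula.

To see that every graph is realised, place p and q in a Lorentzian plane with
null coordinates (u, v), where the form is a positive multiple of uv (after
exchanging time and space when rho is sigma) and q - p is (3, 3), (3, 0) or
(3, -3).  Such a plane needs only a square root of the spatial square norm of
q - p, which is where n = 2 or the Euclidean hypothesis enters.  In the plane,
adjacency means that u and v are both strictly ordered in the same direction,
and an 8 x 8 grid already contains points x, y for each of the 32 graphs. *)

Require Import Defs.
From mathcomp Require Import all_boot all_order all_algebra.
From mathcomp Require Import boolp classical_sets functions cardinality.
From mathcomp Require Import ring lra.

Import Order.TTheory GRing.Theory Num.Theory.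
Local Open Scope classical_set_scope.
Local Open Scope ring_scope.

(** * Quantifier-free types and the back-and-forth argument *)

Section TwoQuantifiers.
Set Implicit Arguments.
Unset Strict Implicit.
Variables (T : eqType) (rho : set (T * T)).

Definition adjacent (x y : T) : bool := `[< rho (x, y) >].

(** In other words, [e i |-> e' i] is a well-defined partial isomorphism. *)
Definition same_type k (e e' : 'I_k -> T) : Prop :=
  forall i j, (e i == e j) = (e' i == e' j) /\
              adjacent (e i) (e j) = adjacent (e' i) (e' j).

Definition all_four_point_types (p q : T) : Prop :=
  forall b1 b2 b3 b4 b5 : bool, exists x y : T, [/\ uniq [:: p; q; x; y],
    adjacent p x = b1 /\ adjacent q x = b2,
    adjacent p y = b3 /\ adjacent q y = b4 & adjacent x y = b5].

Lemma same_type_sat k (f : formula k) (e e' : 'I_k -> T) :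
  quantifier_free f -> same_type e e' -> sat rho e f -> sat rho e' f.
Proof.
(* Negation swaps the two environments, so the induction runs on the equivalence. *)
move=> qf h; suff : sat rho e f <-> sat rho e' f by case.
elim: f qf e e' h => //= [k' i j|k' i j|k' g IH|k' g IHg f IHf|k' g IHg f IHf] qf e e' h.
- by have [eq_ij _] := h i j; split=> /eqP ?; apply/eqP; congruence.
- have [_ adj_ij] := h i j.
  by split=> /asboolP ?; apply/asboolP; rewrite /adjacent in adj_ij; congruence.
- by rewrite (IH qf e e' h).
- by case/andP: qf => qg qf; rewrite (IHg qg e e' h) (IHf qf e e' h).
- by case/andP: qf => qg qf; rewrite (IHg qg e e' h) (IHf qf e e' h).
Qed.

Hypothesis adjacentC : forall x y, adjacent x y = adjacent y x.
Hypothesis adjacentxx : forall x, adjacent x x = false.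

(** Symmetry and irreflexivity leave only the new point against the old ones to compare. *)
Lemma same_type_extend k (e e' : 'I_k -> T) (x x' : T) :
  same_type e e' ->
  (forall i, (x == e i) = (x' == e' i) /\
             adjacent x (e i) = adjacent x' (e' i)) ->
  same_type (extend_env x e) (extend_env x' e').
Proof.
move=> h hx i j; rewrite /extend_env.
case: (unliftP ord0 i) => [i'|] _; case: (unliftP ord0 j) => [j'|] _ //.
- by rewrite ![_ == x]eq_sym ![adjacent _ x]adjacentC
    ![_ == x']eq_sym ![adjacent _ x']adjacentC.
- by rewrite !eqxx !adjacentxx.
Qed.

Lemma same_type_pair (p q p' q' : T) :
  (p == q) = (p' == q') -> adjacent p q = adjacent p' q' ->
  same_type (pair_env p q) (pair_env p' q').
Proof.
move=> heq hadj i j; rewrite /pair_env.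
case: (i == ord0); case: (j == ord0) => //; rewrite ?eqxx ?adjacentxx //.
by rewrite eq_sym heq eq_sym adjacentC hadj adjacentC.
Qed.

Lemma extend_pair (p q p' q' x x' : T) :
  (p == q) = (p' == q') -> adjacent p q = adjacent p' q' ->
  (x == p) = (x' == p') -> adjacent x p = adjacent x' p' ->
  (x == q) = (x' == q') -> adjacent x q = adjacent x' q' ->
  same_type (extend_env x (pair_env p q)) (extend_env x' (pair_env p' q')).
Proof.
move=> *; apply: same_type_extend; first exact: same_type_pair.
by move=> i; rewrite /pair_env; case: (i == ord0).
Qed.

Lemma extend2_pair (p q p' q' x x' y y' : T) :
  same_type (extend_env x (pair_env p q)) (extend_env x' (pair_env p' q')) ->
  (y == p) = (y' == p') -> adjacent y p = adjacent y' p' ->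
  (y == q) = (y' == q') -> adjacent y q = adjacent y' q' ->
  (y == x) = (y' == x') -> adjacent y x = adjacent y' x' ->
  same_type (extend_env y (extend_env x (pair_env p q)))
            (extend_env y' (extend_env x' (pair_env p' q'))).
Proof.
move=> h *; apply: same_type_extend => // i.
rewrite /extend_env; case: (unliftP ord0 i) => [j|] _ //.
by rewrite /pair_env; case: (j == ord0).
Qed.

(** If [x], [y] meet [p], [q] or each other, at most one new point has to be found and [one]
    supplies it; otherwise the four points are distinct and [types] applies directly. *)
Lemma back_and_forth (p q p' q' : T) :
  all_four_point_types p' q' -> p != q -> p' != q' ->
  adjacent p q = adjacent p' q' ->
  forall x y, exists x' y',
    same_type (extend_env y (extend_env x (pair_env p q)))
              (extend_env y' (extend_env x' (pair_env p' q'))).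
Proof.
move=> types npq np'q' hpq x y.
have heq : (p == q) = (p' == q') by rewrite (negPf npq) (negPf np'q').
have one z : exists z', [/\ (z == p) = (z' == p'), adjacent z p = adjacent z' p',
    (z == q) = (z' == q') & adjacent z q = adjacent z' q'].
  have [->|nzp] := eqVneq z p; first by exists p'; rewrite !eqxx !adjacentxx.
  have [->|nzq] := eqVneq z q.
    by exists q'; rewrite eqxx adjacentxx ![q' == _]eq_sym
      (negPf np'q') adjacentC hpq adjacentC.
  (* Only the first of the two points is kept, so the last three booleans are arbitrary. *)
  have [z' [? [/=]]] := types (adjacent p z) (adjacent q z) true true true.
  rewrite !inE !negb_or => /and4P[/and3P[_ np'z' _] /andP[nq'z' _] _ _] [hp hq] _ _.
  by exists z'; rewrite ![z' == _]eq_sym (negPf np'z') (negPf nq'z') ![adjacent _ p]adjacentC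
    ![adjacent _ q]adjacentC ![adjacent z' _]adjacentC hp hq.
(* Once [x'] and [y'] match [x] and [y] separately over the base pair, only the pair [x], [y]
   remains to be compared. *)
have done_y x' y' : [/\ (x == p) = (x' == p'), adjacent x p = adjacent x' p',
    (x == q) = (x' == q') & adjacent x q = adjacent x' q'] ->
    [/\ (y == p) = (y' == p'), adjacent y p = adjacent y' p',
    (y == q) = (y' == q') & adjacent y q = adjacent y' q'] ->
    (y == x) = (y' == x') -> adjacent y x = adjacent y' x' ->
    exists x' y', same_type (extend_env y (extend_env x (pair_env p q)))
              (extend_env y' (extend_env x' (pair_env p' q'))).
  move=> [? ? ? ?] [? ? ? ?] ? ?; exists x', y'.
  by apply: extend2_pair => //; exact: extend_pair.
have heq' : (q == p) = (q' == p') by rewrite ![_ == p]eq_sym ![_ == p']eq_sym.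
have hpq' : adjacent q p = adjacent q' p' by rewrite adjacentC hpq adjacentC.
have [x' hx'] := one x; have [y' hy'] := one y.
have [hx1 hx2 hx3 hx4] := hx'; have [hy1 hy2 hy3 hy4] := hy'.
have [exp|nxp] := eqVneq x p.
  by apply: (done_y p' y') => //; rewrite exp ?eqxx ?adjacentxx.
have [exq|nxq] := eqVneq x q.
  by apply: (done_y q' y') => //; rewrite exq ?eqxx ?adjacentxx.
have [eyp|nyp] := eqVneq y p.
  apply: (done_y x' p') => //; rewrite eyp ?eqxx ?adjacentxx //.
    by rewrite eq_sym hx1 eq_sym.
  by rewrite adjacentC hx2 adjacentC.
have [eyq|nyq] := eqVneq y q.
  apply: (done_y x' q') => //; rewrite eyq ?eqxx ?adjacentxx //.
    by rewrite eq_sym hx3 eq_sym.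
  by rewrite adjacentC hx4 adjacentC.
have [eyx|nyx] := eqVneq y x.
  by apply: (done_y x' x') => //; rewrite eyx ?eqxx ?adjacentxx.
have [u [v [/=]]] := types (adjacent x p) (adjacent x q) (adjacent y p)
  (adjacent y q) (adjacent y x).
rewrite !inE !negb_or => /and4P[/and3P[_ n1 n2] /andP[n3 n4] n5 _] [h1 h2] [h3 h4] h5.
by apply: (done_y u v); rewrite ?(negPf nxp) ?(negPf nxq) ?(negPf nyp) ?(negPf nyq)
  ?(negPf nyx) ?[_ == p']eq_sym ?[_ == q']eq_sym ?[v == u]eq_sym ?(negPf n1) ?(negPf n2)
  ?(negPf n3) ?(negPf n4) ?(negPf n5) ?[adjacent _ p']adjacentC
  ?[adjacent _ q']adjacentC ?[adjacent v u]adjacentC.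
Qed.

Hypothesis homogeneous : forall p p', exists g : T -> T,
  [/\ injective g, forall x y, adjacent (g x) (g y) = adjacent x y & g p = p'].
Hypothesis types : forall p q, p != q -> all_four_point_types p q.

(** For [p != q] the witnesses come from [back_and_forth]. For [p = q] the four-point property says
    nothing, and the witnesses are carried over by an adjacency-preserving injection sending [p] to
    [p']. *)
Lemma existential2_atomic (f : formula 2) (p q p' q' : T) :
  existential2 f -> (p == q) = (p' == q') -> adjacent p q = adjacent p' q' ->
  sat rho (pair_env p q) f -> sat rho (pair_env p' q') f.
Proof.
move=> [psi qf ->] /= heq hadj [x [y hs]].
suff [x' [y' h]] : exists x' y',
    same_type (extend_env y (extend_env x (pair_env p q)))
              (extend_env y' (extend_env x' (pair_env p' q'))).
  by exists x', y'; exact: same_type_sat hs.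
have [epq|npq] := eqVneq p q; last first.
  have np'q' : p' != q' by rewrite -heq npq.
  exact: back_and_forth (types np'q') npq np'q' hadj x y.
move: heq; rewrite epq eqxx => /esym/eqP <-.
have [g [ginj gadj <-]] := homogeneous q p'.
by exists (g x), (g y); apply: extend2_pair; [apply: extend_pair|..];
  rewrite ?(inj_eq ginj) ?gadj ?eqxx ?adjacentxx.
Qed.

(** * Boolean combinations as unions of pair types *)

Definition select (b : bool * bool * bool) (eq adj : bool) : bool :=
  if eq then b.1.1 else if adj then b.1.2 else b.2.

(** The bits of [b] choose among three classes of pairs, in this order: equal, adjacent, distinct
    and non-adjacent. *)
Definition atoms (b : bool * bool * bool) : set (T * T) :=
  [set pq | select b (pq.1 == pq.2) (adjacent pq.1 pq.2)].

(** An invariant relation contains each of the three classes that it meets, so [b] records which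
    classes it meets. *)
Lemma atoms_atomic (R : set (T * T)) :
  (forall p q p' q', (p == q) = (p' == q') -> adjacent p q = adjacent p' q' ->
    R (p, q) -> R (p', q')) ->
  exists b, R = atoms b.
Proof.
move=> atomic.
pose has_atom e a := `[< exists p q, [/\ p == q = e, adjacent p q = a & R (p, q)] >].
exists (has_atom true false, has_atom false true, has_atom false false).
apply/seteqP; split=> -[p q]; rewrite /atoms /select /=.
  move=> Rpq; have [epq|npq] := eqVneq p q.
    by apply/asboolP; exists p, q; split=> //; rewrite epq ?eqxx ?adjacentxx.
  by case E: (adjacent p q); apply/asboolP; exists p, q; split=> //; apply: negPf.
have [epq|npq] := eqVneq p q.
  move=> /asboolP[p' [q' [e a]]]; apply: atomic; rewrite ?e ?a epq ?eqxx ?adjacentxx //.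
by case E: (adjacent p q) => /asboolP[p' [q' [e a]]]; apply: atomic;
  rewrite ?e ?a ?(negPf npq).
Qed.

Lemma boolean_closure_atoms b : boolean_closure rho (atoms b).
Proof.
pose E := [set pq : T * T | pq.1 = pq.2].
(* The closure has no constants: for [c = false] the empty set is obtained as the intersection of
   [A] with its complement. *)
have restrict (c : bool) A : boolean_closure rho A ->
    boolean_closure rho [set pq | c && `[< A pq >]].
  move=> hA; case: c.
    suff -> : [set pq | true && `[< A pq >]] = A by [].
    by apply/seteqP; split=> pq /= /asboolP.
  suff -> : [set pq | false && `[< A pq >]] = A `&` ~` A.
    by apply: closureI => //; exact: closureC.
  by apply/seteqP; split=> pq //= [].
have hE : boolean_closure rho E by exact: closure_eq.
have hN := closureC hE; have hR := closure_rho rho; have hR' := closureC hR.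
suff -> : atoms b = [set pq | b.1.1 && `[< E pq >]] `|`
    ([set pq | b.1.2 && `[< (~` E `&` rho) pq >]] `|`
     [set pq | b.2 && `[< (~` E `&` ~` rho) pq >]]).
  by do 2?apply: closureU; apply: restrict => //; exact: closureI.
apply/seteqP; split=> -[p q]; rewrite /atoms /select /adjacent /E /=.
  case: eqP => [->|npq]; first by move=> ->; left; apply/asboolP.
  case: asboolP => [rpq|nrpq] ->; right; [left|right]; exact/asboolP.
case=> [/andP[b1 /asboolP ->]|]; first by rewrite eqxx.
by case=> /andP[b1 /asboolP [/= /eqP/negPf ->]] => [/asboolP|/asboolPn/negPf] ->.
Qed.

Lemma boolean_closureE : boolean_closure rho = range atoms.
Proof.
apply/seteqP; split=> [R|_ [b _ <-]]; last exact: boolean_closure_atoms.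
move=> clR; suff [b ->] : exists b, R = atoms b by exists b.
apply: atoms_atomic.
elim: R / clR => [||A B _ IA _ IB|A B _ IA _ IB|A _ IA]
    p q p' q' heq hadj /=.
- by move/asboolP; rewrite -/(adjacent p q) hadj => /asboolP.
- by move/eqP; rewrite heq => /eqP.
- by case=> /(IA _ _ _ _ heq hadj) ? /(IB _ _ _ _ heq hadj).
- by case=> [/(IA _ _ _ _ heq hadj)|/(IB _ _ _ _ heq hadj)]; [left|right].
- by apply: contra_not; exact: IA.
Qed.

Lemma boolean_closure_definable R :
  boolean_closure rho R -> definable_by rho (@quantifier_free 2) R.
Proof.
elim=> {R} [||A B _ [f qf hf] _ [g qg hg]|A B _ [f qf hf] _ [g qg hg]|A _ [f qf hf]].
- by exists (FRel ord0 ord_max).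
- by exists (FEq ord0 ord_max).
- by exists (FAnd f g) => [|p q] /=; [rewrite qf qg|rewrite -hf -hg].
- by exists (FOr f g) => [|p q] /=; [rewrite qf qg|rewrite -hf -hg].
- by exists (FNot f) => // p q /=; rewrite -hf.
Qed.

(** The 8 triples give distinct relations because all three classes of pairs are inhabited. *)
Lemma boolean_closure_card (p0 q0 : T) : p0 != q0 ->
  (boolean_closure rho #= `I_8)%card.
Proof.
move=> np0q0; rewrite boolean_closureE.
(* Only the first and third booleans matter: [x] is adjacent to [p0] and [y] is not. *)
have [x [y [/= + [h1 _] [h2 _] _]]] := types np0q0 true true false false false.
rewrite !inE !negb_or => /and4P[/and3P[_ nx ny] _ _ _].
apply: (card_eq_trans (B := [set: bool * bool * bool])).
  apply: inj_card_eq => -[[a b] c] [[a' b'] c'] _ _ eqA.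
  have at_ z : select (a, b, c) (p0 == z) (adjacent p0 z) =
               select (a', b', c') (p0 == z) (adjacent p0 z).
    by apply/idP/idP => h; [have : atoms (a', b', c') (p0, z) by rewrite -eqA
                           |have : atoms (a, b, c) (p0, z) by rewrite eqA].
  have := at_ p0; have := at_ x; have := at_ y.
  by rewrite /select eqxx (negPf nx) (negPf ny) h1 h2 /= => -> -> ->.
have -> : 8%N = #|{: bool * bool * bool}| by rewrite !card_prod card_bool.
rewrite card_eq_sym; apply: card_eq_trans card_II _.
rewrite card_eq_sym.
suff -> : [set: 'I_#|{: bool * bool * bool}|] = range (@enum_rank (bool * bool * bool)%type).
  by rewrite card_eq_sym; apply: inj_card_eq => a b _ _; exact: enum_rank_inj.
by apply/seteqP; split=> // i _; exists (enum_val i); rewrite ?enum_valK.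
Qed.

Lemma definable2_boolean_closure R :
  definable_by rho existential2 R \/ definable_by rho universal2 R ->
  boolean_closure rho R.
Proof.
suff ex S : definable_by rho existential2 S -> boolean_closure rho S.
  case=> [/ex //|[_ [psi qf ->] hR]].
  (* The complement of a universally defined relation is existentially defined, by the negated
     matrix. *)
  rewrite -[R]setCK; apply/closureC/ex.
  exists (FExists (FExists (FNot psi))); first by exists (FNot psi).
  move=> p q; rewrite /setC /= hR /=; split.
    by move=> /existsNP[x /existsNP[y hxy]]; exists x, y.
  by move=> [x [y hxy]] /(_ x y).
move=> [f exf hf]; rewrite boolean_closureE.
have [|b ->] := @atoms_atomic S; last by exists b.
by move=> p q p' q' heq hadj /hf h; apply/hf; exact: existential2_atomic h.
Qed.

End TwoQuantifiers.

(** * Finite configurations in the null-coordinate grid *)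

Definition plane_adjacent (x y : nat * nat) : bool :=
  ((x.1 < y.1) && (x.2 < y.2) || (y.1 < x.1) && (y.2 < x.2))%N.

(** The values 2 and 5 leave two values of [iota 0 8] below, between and above them for the new
    points. The three base pairs are timelike, lightlike and spacelike for the form [u * v]. *)
Lemma plane_four_point_types (p q : nat * nat) (b1 b2 b3 b4 b5 : bool) :
  (p, q) \in [:: ((2, 2), (5, 5)); ((2, 2), (5, 2)); ((2, 5), (5, 2))]%N ->
  exists x y : nat * nat, [/\ uniq [:: p; q; x; y],
    plane_adjacent p x = b1 /\ plane_adjacent q x = b2,
    plane_adjacent p y = b3 /\ plane_adjacent q y = b4 &
    plane_adjacent x y = b5].
Proof.
pose bools := [:: true; false].
pose grid := [seq (u, v) | u <- iota 0 8, v <- iota 0 8].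
have mem_bools b : b \in bools by case: b.
(* A search over natural numbers, settled by computation; [x] is tested before [y] is sought. *)
have : all (fun pq : (nat * nat) * (nat * nat) =>
    all (fun c1 => all (fun c2 => all (fun c3 => all (fun c4 => all (fun c5 =>
      has (fun x => [&& x \notin [:: pq.1; pq.2], plane_adjacent pq.1 x == c1,
          plane_adjacent pq.2 x == c2 &
          has (fun y => [&& y \notin [:: pq.1; pq.2; x],
            plane_adjacent pq.1 y == c3, plane_adjacent pq.2 y == c4 &
            plane_adjacent x y == c5]) grid]) grid)
    bools) bools) bools) bools) bools)
  [:: ((2, 2), (5, 5)); ((2, 2), (5, 2)); ((2, 5), (5, 2))]%N by lazy.
move=> /allP h pq; have npq : p != q.
  by move: pq; rewrite !inE => /or3P[] /eqP[-> ->].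
move/h: pq => /allP/(_ b1 (mem_bools _))/allP/(_ b2 (mem_bools _))
  /allP/(_ b3 (mem_bools _))/allP/(_ b4 (mem_bools _))/allP/(_ b5 (mem_bools _)).
move=> /hasP[x _ /and4P[nx /eqP hx1 /eqP hx2]]
  /hasP[y _ /and4P[ny /eqP hy1 /eqP hy2 /eqP hxy]].
exists x, y; split => //; move: nx ny.
rewrite /= !inE !negb_or npq /= => /andP[nx1 nx2] /and3P[ny1 ny2 ny3].
by rewrite ![p == _]eq_sym ![q == _]eq_sym [x == y]eq_sym nx1 nx2 ny1 ny2 ny3.
Qed.

(** * The Lorentzian form and its null frames *)

Section Minkowski.
Set Implicit Arguments.
Unset Strict Implicit.
Variables (Q : realFieldType) (n : nat) (hn : (2 <= n)%N).

Definition form (d : 'rV[Q]_n) : Q :=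
  d 0 (time_index hn) ^+ 2 - \sum_(i < n | (1 <= i)%N) d 0 i ^+ 2.

Lemma formN d : form (- d) = form d.
Proof.
by rewrite /form !mxE sqrrN; congr (_ - _); apply: eq_bigr => i _; rewrite !mxE sqrrN.
Qed.

Lemma form0 : form 0 = 0.
Proof.
by rewrite /form mxE expr0n big1 ?subrr // => i _; rewrite mxE expr0n.
Qed.

Lemma formB (p q : 'rV[Q]_n) : form (p - q) = time_sq hn p q - space_sq p q.
Proof. by rewrite /form !mxE; under eq_bigr do rewrite !mxE. Qed.

(** The factor 1 gives [tau] the shape [0 < s * form] that [sigma] has with [s = -1], so one
    argument serves both. *)
Lemma tauE : tau hn = [set pq | 0 < 1 * form (pq.1 - pq.2)].
Proof.
by rewrite /tau; apply/seteqP; split=> -[p q]; rewrite /= mul1r formB subr_gt0.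
Qed.

Lemma sigmaE : sigma hn = [set pq | 0 < -1 * form (pq.1 - pq.2)].
Proof.
by rewrite /sigma; apply/seteqP; split=> -[p q];
  rewrite /= mulN1r formB opprB subr_gt0.
Qed.

(** For [n = 2] the sum has a single term, already a square; otherwise the Euclidean hypothesis
    gives the root. *)
Lemma spatial_norm (d : 'rV[Q]_n) : n = 2%N \/ euclidean Q ->
  exists r, r ^+ 2 = \sum_(i < n | (1 <= i)%N) d 0 i ^+ 2.
Proof.
case=> [n2|euc]; last first.
  have [|r ->] := euc (\sum_(i < n | (1 <= i)%N) d 0 i ^+ 2); last by exists r.
  by apply: sumr_ge0 => i _; exact: sqr_ge0.
exists (d 0 (Ordinal hn)); rewrite (big_pred1 (Ordinal hn)) // => i.
by rewrite /= -val_eqE /=; have := ltn_ord i; rewrite {2}n2; case: (val i) => [|[|]].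
Qed.

(* For r the length of the spatial vector x, the null vectors (r, x) and (r, - x). *)
Lemma null_pair (x d : 'rV[Q]_n) (r k : Q) : r != 0 ->
  r ^+ 2 = \sum_(i < n | (1 <= i)%N) x 0 i ^+ 2 ->
  (forall i : 'I_n, (1 <= i)%N -> d 0 i = k * x 0 i) ->
  exists a b alpha beta, d = alpha *: a + beta *: b /\
    exists2 c, c != 0 & forall u v, form (u *: a + v *: b) = c * (u * v).
Proof.
move=> r0 hr hd; pose t := d 0 (time_index hn).
pose a := \row_i if i == time_index hn then r else x 0 i.
pose b := \row_i if i == time_index hn then r else - x 0 i.
(* The coefficients solve [alpha + beta = t / r] (time) and [alpha - beta = k] (space). *)
exists a, b, ((t / r + k) / 2), ((t / r - k) / 2); split.
  apply/rowP => i; rewrite !mxE; case: eqP => [->|ni]; first by rewrite -/t; field.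
  rewrite hd; first by field.
  by rewrite lt0n; apply/eqP => i0; apply: ni; apply: val_inj.
(* The form is [(u + v)^2 r^2 - (u - v)^2 r^2 = 4 r^2 u v]. *)
exists (4 * r ^+ 2) => [|u v]; first by rewrite mulf_neq0 ?expf_neq0 // pnatr_eq0.
have spatial : \sum_(i < n | (1 <= i)%N) (u *: a + v *: b) 0 i ^+ 2 =
    (u - v) ^+ 2 * r ^+ 2.
  rewrite hr mulr_sumr; apply: eq_bigr => i i1; rewrite !mxE.
  have -> : (i == time_index hn) = false by rewrite -val_eqE /=; case: (val i) i1.
  by ring.
by rewrite /form spatial !mxE eqxx; ring.
Qed.

Lemma null_coordinates (d : 'rV[Q]_n) : n = 2%N \/ euclidean Q ->
  exists a b alpha beta, d = alpha *: a + beta *: b /\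
    exists2 c, c != 0 & forall u v, form (u *: a + v *: b) = c * (u * v).
Proof.
move=> hQ; have [r hr] := spatial_norm d hQ.
have [r0|r0] := eqVneq r 0; last first.
  by apply: (@null_pair d d r 1) => // i _; rewrite mul1r.
(* Here [d] has zero spatial part, so a unit spatial vector with [k = 0] completes the plane. *)
apply: (@null_pair (delta_mx 0 (Ordinal hn)) d 1 0); first exact: oner_neq0.
  rewrite expr1n (bigD1 (Ordinal hn)) //= big1 ?addr0 => [|i /andP[_ /negPf ni]].
    by rewrite mxE !eqxx expr1n.
  by rewrite mxE ni andbF expr0n.
move: hr; rewrite r0 expr0n /= => /esym/eqP.
rewrite psumr_eq0 => [/allP h i i1|i _]; last exact: sqr_ge0.
by rewrite mul0r; apply/eqP; have := h i (mem_index_enum _); rewrite i1 sqrf_eq0.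
Qed.

(* Rescaling and exchanging the null directions puts the second point at
   (3, 3), (3, 0) or (3, -3). *)
Lemma null_frame (s : Q) (d : 'rV[Q]_n) : n = 2%N \/ euclidean Q ->
  s != 0 -> d != 0 ->
  exists a b w c, [/\ w \in [:: 1; 0; -1], d = 3 *: a + (3 * w) *: b, 0 < c &
    forall u v, s * form (u *: a + v *: b) = c * (u * v)].
Proof.
move=> hQ s0 d0; have [a [b [al [be [hd [c c0 hc]]]]]] := null_coordinates d hQ.
have three0 : (3 : Q) != 0 by rewrite pnatr_eq0.
(* Negating one null direction, if necessary, makes the constant positive. *)
have [b' [be' [hd' [c' c'0 hc']]]] : exists b' be', d = al *: a + be' *: b' /\
    exists2 c, 0 < c & forall u v, s * form (u *: a + v *: b') = c * (u * v).
  have sc0 : s * c != 0 by rewrite mulf_neq0.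
  case: (ltrgtP 0 (s * c)) sc0 => // sc _.
    by exists b, be; split=> //; exists (s * c) => // u v; rewrite hc; ring.
  exists (- b), (- be); rewrite scalerN scaleNr opprK; split=> //.
  exists (- (s * c)) => [|u v]; first by rewrite oppr_gt0.
  by rewrite scalerN -scaleNr hc; ring.
have sq_gt0 (x : Q) : x != 0 -> 0 < x ^+ 2 by move=> x0; rewrite exprn_even_gt0.
have [be0|be0] := eqVneq be' 0.
  have al0 : al != 0.
    by apply: contraNneq d0 => al0; rewrite hd' al0 be0 !scale0r addr0.
  (* The second direction is rescaled by the same factor, so the constant is multiplied by a square
     and stays positive. *)
  exists ((al / 3) *: a), ((al / 3) *: b'), 0, (c' * (al / 3) ^+ 2); split.
  - by rewrite !inE eqxx orbT.
  - by rewrite hd' be0 mulr0 !scale0r !addr0 scalerA; congr (_ *: _); field.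
  - by rewrite mulr_gt0 // sq_gt0 // mulf_neq0 ?invr_eq0.
  - by move=> u v; rewrite !scalerA hc'; ring.
have [al0|al0] := eqVneq al 0.
  exists ((be' / 3) *: b'), ((be' / 3) *: a), 0, (c' * (be' / 3) ^+ 2); split.
  - by rewrite !inE eqxx orbT.
  - by rewrite hd' al0 mulr0 !scale0r addr0 add0r scalerA; congr (_ *: _); field.
  - by rewrite mulr_gt0 // sq_gt0 // mulf_neq0 ?invr_eq0.
  - by move=> u v; rewrite !scalerA addrC hc'; ring.
have ab0 : al * be' != 0 by rewrite mulf_neq0.
(* The sign of [al * be'] decides [w]; in the negative case the sign is absorbed into the second
   direction. *)
case: (ltrgtP 0 (al * be')) ab0 => // ab _.
  exists ((al / 3) *: a), ((be' / 3) *: b'), 1, (c' * (al * be' / 9)); split.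
  - by rewrite !inE eqxx.
  - by rewrite hd' !scalerA; congr (_ *: _ + _ *: _); field.
  - by rewrite mulr_gt0 // divr_gt0 // ltr0n.
  - by move=> u v; rewrite !scalerA hc'; field.
exists ((al / 3) *: a), ((- be' / 3) *: b'), (-1), (c' * (- (al * be') / 9)); split.
- by rewrite !inE eqxx !orbT.
- by rewrite hd' !scalerA; congr (_ *: _ + _ *: _); field.
- by rewrite mulr_gt0 // divr_gt0 ?oppr_gt0 // ltr0n.
- by move=> u v; rewrite !scalerA hc'; field.
Qed.

Lemma plane_adjacentE (x y : nat * nat) :
  (0 < (x.1%:R - y.1%:R) * (x.2%:R - y.2%:R) :> Q) = plane_adjacent x y.
Proof.
rewrite /plane_adjacent; case: (ltngtP x.1 y.1) => [h|h|->]; last by rewrite subrr mul0r ltxx.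
  by rewrite nmulr_rgt0 ?subr_lt0 ?ltr_nat //= orbF.
by rewrite pmulr_rgt0 ?subr_gt0 ?ltr_nat.
Qed.

(** An affine map [g] of the grid sends a base pair to [p], [q] and turns [plane_adjacent] into
    adjacency, so the grid configurations transfer. *)
Lemma minkowski_four_point_types (s : Q) (p q : 'rV[Q]_n) :
  n = 2%N \/ euclidean Q -> s != 0 -> p != q ->
  all_four_point_types [set pq | 0 < s * form (pq.1 - pq.2)] p q.
Proof.
move=> hQ s0 npq b1 b2 b3 b4 b5.
have [|a [b [w [c [hw hd c0 hc]]]]] := @null_frame s (q - p) hQ s0.
  by rewrite subr_eq0 eq_sym.
have [v0 [v1 [hv mem_v]]] : exists v0 v1 : nat, (v1%:R - v0%:R = 3 * w :> Q) /\
    ((2, v0), (5, v1)) \in [:: ((2, 2), (5, 5)); ((2, 2), (5, 2)); ((2, 5), (5, 2))]%N.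
  move: hw; rewrite !inE => /or3P[] /eqP ->; [exists 2%N, 5%N|exists 2%N, 2%N|exists 5%N, 2%N];
    by split=> //; lra.
pose g (x : nat * nat) : 'rV[Q]_n := p + ((x.1%:R - 2) *: a + (x.2%:R - v0%:R) *: b).
have gB x y : g x - g y = (x.1%:R - y.1%:R) *: a + (x.2%:R - y.2%:R) *: b.
  by apply/rowP => i; rewrite !mxE; ring.
have gadj x y : adjacent [set pq | 0 < s * form (pq.1 - pq.2)] (g x) (g y) =
    plane_adjacent x y.
  by rewrite /adjacent asboolb gB hc pmulr_rgt0 // plane_adjacentE.
have ginj : injective g.
  (* If [u *: a + v *: b = 0], shifting coordinates by [(u, v)] preserves the product [u' * v'];
     evaluating at [(0, 0)], [(0, 1)] and [(1, 0)] forces [u = v = 0]. *)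
  have indep u v : u *: a + v *: b = 0 -> u = 0 /\ v = 0.
    move=> h; have shift u' v' : u' * v' = (u + u') * (v + v').
      apply: (@mulfI _ c); first by rewrite gt_eqF.
      by rewrite -!hc !scalerDl addrACA h add0r.
    by have := shift 0 0; have := shift 0 1; have := shift 1 0; split; lra.
  move=> [x1 x2] [y1 y2] /eqP; rewrite -subr_eq0 gB => /eqP/indep[/eqP + /eqP].
  by rewrite !subr_eq0 !eqr_nat => /eqP /= -> /eqP ->.
have gp : g (2, v0)%N = p by rewrite /g !subrr !scale0r !addr0.
have gq : g (5, v1)%N = q.
  rewrite /g hv -[q in RHS](subrKC p) hd; congr (_ + (_ *: _ + _ *: _)).
  by rewrite /=; lra.
have [x [y [huniq [h1 h2] [h3 h4] h5]]] := plane_four_point_types b1 b2 b3 b4 b5 mem_v.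
by exists (g x), (g y); rewrite -gp -gq !gadj -(map_inj_uniq ginj) in huniq *.
Qed.

End Minkowski.

Theorem theorem4p6 (Q : realFieldType) (n : nat) (hn : (2 <= n)%N)
    (hQ : n = 2%N \/ euclidean Q)
    (rho : set ('rV[Q]_n * 'rV[Q]_n))
    (hrho : rho = tau hn \/ rho = sigma hn) :
  (boolean_closure rho #= `I_8)%card /\
  forall R : set ('rV[Q]_n * 'rV[Q]_n),
    definable_by rho existential2 R \/ definable_by rho universal2 R ->
    definable_by rho (@quantifier_free 2) R /\ boolean_closure rho R.
Proof.
have [s s0 ->] : exists2 s : Q, s != 0 &
    rho = [set pq | 0 < s * form hn (pq.1 - pq.2)].
  case: hrho => ->; first by exists 1; [exact: oner_neq0|exact: tauE].
  by exists (-1); [rewrite oppr_eq0 oner_neq0|exact: sigmaE].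
set r := [set pq | _].
have rC x y : adjacent r x y = adjacent r y x.
  by rewrite /adjacent /r /= -formN opprB.
have rxx x : adjacent r x x = false.
  by apply/asboolPn; rewrite /r /= subrr form0 mulr0 ltxx.
have hom p p' : exists g : 'rV[Q]_n -> 'rV[Q]_n,
    [/\ injective g, forall x y, adjacent r (g x) (g y) = adjacent r x y & g p = p'].
  (* Translations preserve differences, hence adjacency, and act transitively. *)
  exists (fun x => x + (p' - p)); split; first exact: addIr.
    by move=> x y; rewrite /adjacent /r /= opprD addrACA subrr addr0.
  by rewrite addrC subrK.
have types p q : p != q -> all_four_point_types r p q.
  exact: minkowski_four_point_types.
split.
  apply: (@boolean_closure_card _ _ rxx types 0 (const_mx 1)).
  by apply/eqP => /rowP/(_ (Ordinal hn)); rewrite !mxE => /esym/eqP; rewrite oner_eq0.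
move=> R hR; have clR := definable2_boolean_closure rC rxx hom types hR.
by split=> //; exact: boolean_closure_definable.
Qed.
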